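(* Let $K$ and $L$ be real skew-symmetric $d\times d$ matrices, let $S$ be a scalar function with $\nabla S(z)=Pz$ for a constant $d\times d$ matrix $P$, and consider the linear multi-symplectic PDE $Kz_t+Lz_x=Pz$. Suppose the simple diamond scheme is structurally inconsistent on this PDE. Then the coefficient matrix $\frac{K}{\Delta t}-\frac{P}{4}$ is singular.
   Context: **Simple diamond scheme.** Let $\Delta t,\Delta x>0$ be the mesh sizes. On each diamond-shaped cell, with vectors $z^{\mathrm b}, z_{\mathrm l}, z_{\mathrm r}\in\mathbb{R}^d$ given at the bottom, left and right corners, the vector $z^{\mathrm t}\in\mathbb{R}^d$ at the top corner is the unknown of $$K\,\frac{z^{\mathrm t}-z^{\mathrm b}}{\Delta t}+L\,\frac{z_{\mathrm r}-z_{\mathrm l}}{\Delta x}=P\,\frac{z^{\mathrm t}+z^{\mathrm b}+z_{\mathrm r}+z_{\mathrm l}}{4},$$ equivalently $$\Big(\frac{K}{\Delta t}-\frac P4\Big)z^{\mathrm t}=\frac{K}{\Delta t}z^{\mathrm b}-\frac{L}{\Delta x}(z_{\mathrm r}-z_{\mathrm l})+P\,\frac{z^{\mathrm b}+z_{\mathrm r}+z_{\mathrm l}}{4}.$$ The matrix $\frac{K}{\Delta t}-\frac P4$ is the coefficient matrix of the scheme. **Equation–unknown bipartite graph.** Let $\mathcal{E}=\{e_1,\dots,e_d\}$ be the set of the $d$ scalar equations of this local system and $\mathcal{U}=\{z^{\mathrm t}_1,\dots,z^{\mathrm t}_d\}$ the set of its scalar unknowns. The bipartite graph $G_{\rm bi}=(\mathcal{E}\sqcup\mathcal{U},E)$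 has an edge between $e_i$ and $z^{\mathrm t}_j$ exactly when the unknown $z^{\mathrm t}_j$ appears in the equation $e_i$, i.e. when $K_{ij}\neq 0$ or $P_{ij}\neq 0$ (the graph records the non-zero patterns of both $K$ and $P$). **Dulmage–Mendelsohn (DM) decomposition.** The DM decomposition of $G_{\rm bi}$ partitions the vertices into blocks $(\mathcal{E}_0,\mathcal{U}_0),(\mathcal{E}_1,\mathcal{U}_1),\dots,(\mathcal{E}_h,\mathcal{U}_h),(\mathcal{E}_\infty,\mathcal{U}_\infty)$. For any fixed maximum matching, $\mathcal{E}_0\sqcup\mathcal{U}_0$ is the set of vertices reachable by alternating paths (including paths of length zero) from equations left unmatched (the overdetermined block), and $\mathcal{E}_\infty\sqcup\mathcal{U}_\infty$ is the set of vertices reachable by alternating paths from unknowns left unmatched (the underdetermined block); these sets do not depend on the chosen maximum matching. The remaining blocks $(\mathcal{E}_k,\mathcal{U}_k)$, $1\le k\le h$, each admit a perfect matching (well-determined blocks). **Structural inconsistency.** The simple diamond scheme is structurally inconsistent on the PDE if the DM decomposition of $G_{\rm bi}$ has a nonempty block $(\mathcal{E}_0,\mathcal{U}_0)$ or a nonempty block $(\mathcal{E}_\infty,\mathcal{U}_\infty)$. *)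

(* Defs.v *)
(* MathComp / MathComp-Analysis; vectors of R^d are columns. *)
From mathcomp Require Import all_boot all_order all_algebra.
From mathcomp Require Import all_classical all_reals all_analysis.
From mathcomp Require Import ring.

Set Implicit Arguments.
Unset Strict Implicit.
Unset Printing Implicit Defensive.

Import Order.TTheory GRing.Theory Num.Theory.
Import numFieldNormedType.Exports.

Local Open Scope ring_scope.

Definition skew_symmetric (R : realType) (d : nat) (A : 'M[R]_d) : Prop :=
  A^T = - A.

(* Only meaningful where [S] is differentiable: 'D_v is a total operator. *)
Definition gradient (R : realType) (d : nat) (S : 'cV[R]_d -> R)
    (z : 'cV[R]_d) : 'cV[R]_d :=
  \col_i 'D_(delta_mx i 0 : 'cV[R]_d) S z.

Definition has_linear_gradient (R : realType) (d : nat) (S : 'cV[R]_d -> R)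
    (P : 'M[R]_d) : Prop :=
  forall z : 'cV[R]_d, differentiable S z /\ gradient S z = P *m z.

Definition diamond_scheme (R : realType) (d : nat) (K L P : 'M[R]_d)
    (dt dx : R) (zb zl zr zt : 'cV[R]_d) : Prop :=
  K *m (dt^-1 *: (zt - zb)) + L *m (dx^-1 *: (zr - zl)) =
  P *m (4^-1 *: (zt + zb + zr + zl)).

Definition coefficient_matrix (R : realType) (d : nat) (K P : 'M[R]_d)
    (dt : R) : 'M[R]_d :=
  dt^-1 *: K - 4^-1 *: P.

Lemma diamond_schemeE (R : realType) (d : nat) (K L P : 'M[R]_d)
    (dt dx : R) (zb zl zr zt : 'cV[R]_d) :
  diamond_scheme K L P dt dx zb zl zr zt <->
  coefficient_matrix K P dt *m zt =
    dt^-1 *: K *m zb - dx^-1 *: L *m (zr - zl)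
      + P *m (4^-1 *: (zb + zr + zl)).
Proof.
rewrite /diamond_scheme /coefficient_matrix mulmxBl -!scalemxAr -!scalemxAl.
rewrite !(mulmxDr, mulmxN, scalerDr, scalerN).
set a := dt^-1 *: (K *m zt); set b := dt^-1 *: (K *m zb).
set l := dx^-1 *: (L *m zl); set r := dx^-1 *: (L *m zr).
set p := 4^-1 *: (P *m zt); set q := 4^-1 *: (P *m zb).
set s := 4^-1 *: (P *m zr); set t := 4^-1 *: (P *m zl).
have -> : (a - b + (r - l) = p + q + s + t) <->
          (a - b + (r - l) - (p + q + s + t) = 0).
  by split=> [->|/eqP]; [rewrite subrr | rewrite subr_eq0 => /eqP].
have -> : (a - p = b - (r - l) + (q + s + t)) <->
          (a - p - (b - (r - l) + (q + s + t)) = 0).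
  by split=> [->|/eqP]; [rewrite subrr | rewrite subr_eq0 => /eqP].
suff -> : a - b + (r - l) - (p + q + s + t) =
          a - p - (b - (r - l) + (q + s + t)) by [].
by apply/matrixP => i j; rewrite !mxE; ring.
Qed.

Section BipartiteGraph.
Variables (E U : finType) (G : E -> U -> bool).

Definition is_matching (M : {set E * U}) : Prop :=
  (forall e u, (e, u) \in M -> G e u) /\
  (forall e u e' u', (e, u) \in M -> (e', u') \in M ->
     e = e' \/ u = u' -> (e, u) = (e', u')).

Definition is_maximum_matching (M : {set E * U}) : Prop :=
  is_matching M /\ (forall N, is_matching N -> (#|N| <= #|M|)%N).

(* Vertices of the graph are [inl e] (equations) and [inr u] (unknowns). *)
Definition adjacent (x y : E + U) : bool :=
  match x, y with
  | inl e, inr u | inr u, inl e => G e u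
  | _, _ => false
  end.

Definition matched_edge (M : {set E * U}) (x y : E + U) : bool :=
  match x, y with
  | inl e, inr u | inr u, inl e => (e, u) \in M
  | _, _ => false
  end.

(* [x :: p] is a walk whose edges lie alternately inside and outside [M],
   the first one inside [M] iff [b]. *)
Fixpoint alternating_from (M : {set E * U}) (b : bool) (x : E + U)
    (p : seq (E + U)) : bool :=
  if p is y :: q then
    [&& adjacent x y, matched_edge M x y == b & alternating_from M (~~ b) y q]
  else true.

Definition alternating_path (M : {set E * U}) (x : E + U) (p : seq (E + U))
    : Prop :=
  uniq (x :: p) /\ exists b, alternating_from M b x p.

Definition reachable (M : {set E * U}) (x y : E + U) : Prop :=
  exists p, alternating_path M x p /\ last x p = y.

Definition unmatched_equation (M : {set E * U}) (e : E) : Prop :=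
  forall u, (e, u) \notin M.

Definition unmatched_unknown (M : {set E * U}) (u : U) : Prop :=
  forall e, (e, u) \notin M.

(* The vertex sets of the overdetermined and underdetermined blocks of the
   Dulmage-Mendelsohn decomposition, when [M] is a maximum matching. *)
Definition DM_overdetermined (M : {set E * U}) : set (E + U) :=
  [set v | exists e, unmatched_equation M e /\ reachable M (inl e) v]%classic.

Definition DM_underdetermined (M : {set E * U}) : set (E + U) :=
  [set v | exists u, unmatched_unknown M u /\ reachable M (inr u) v]%classic.

End BipartiteGraph.

Definition equation_unknown_graph (R : realType) (d : nat) (K P : 'M[R]_d)
    : 'I_d -> 'I_d -> bool :=
  fun i j => (K i j != 0) || (P i j != 0).

(* The two blocks do not depend on the maximum matching used to compute them,
   and a maximum matching always exists, so [exists M] agrees with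
   [forall M, is_maximum_matching _ M -> _]. *)
Definition structurally_inconsistent (R : realType) (d : nat)
    (K P : 'M[R]_d) : Prop :=
  let G := equation_unknown_graph K P in
  exists M : {set 'I_d * 'I_d},
    is_maximum_matching G M /\
    ((DM_overdetermined G M !=set0)%classic \/
     (DM_underdetermined G M !=set0)%classic).

(* Main.v *)
(* If the coefficient matrix is invertible, its Leibniz expansion has a nonzero
   term; the corresponding permutation is a perfect matching of the graph, since
   a nonzero entry of [K / dt - P / 4] forces a nonzero entry of [K] or [P].
   Every maximum matching is then perfect, so no vertex is left unmatched and
   both blocks are empty. *)
Require Import Defs.
From mathcomp Require Import all_boot all_order all_algebra perm.
From mathcomp Require Import all_classical all_reals all_analysis.

Import Order.TTheory GRing.Theory Num.Theory.
Import numFieldNormedType.Exports.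

Local Open Scope ring_scope.

Lemma unitmx_nonzero_transversal (F : fieldType) (n : nat) (A : 'M[F]_n) :
  A \in unitmx -> exists s : 'S_n, forall i, A i (s i) != 0.
Proof.
rewrite unitmxE unitfE => detA.
have [/existsP[s /forallP sA]|/existsPn noperm] :=
  boolP [exists s : 'S_n, [forall i, A i (s i) != 0]]; first by exists s.
(* With no such permutation, every Leibniz term has a zero factor, so the determinant vanishes. *)
case/eqP: detA; rewrite /determinant big1 // => s _.
have /forallPn[i /negPn/eqP Ai0] := noperm s.
by rewrite (bigD1 i) //= Ai0 mul0r mulr0.
Qed.

Lemma coefficient_matrix_edge (R : realType) (d : nat) (K P : 'M[R]_d)
    (dt : R) (i j : 'I_d) :
  coefficient_matrix K P dt i j != 0 -> equation_unknown_graph K P i j.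
Proof.
apply: contraR; rewrite negb_or !negbK => /andP[/eqP Kij0 /eqP Pij0].
by rewrite !mxE Kij0 Pij0 !mulr0 subrr.
Qed.

Section PerfectMatching.
Variables (E U : finType) (G : E -> U -> bool).

(** The graph of [f] is itself a matching with [#|E|] edges, so maximality of [M] gives the
    bound. *)
Lemma card_maximum_matching_ge (f : E -> U) (M : {set E * U}) :
  injective f -> (forall e, G e (f e)) -> is_maximum_matching G M ->
  (#|E| <= #|M|)%N.
Proof.
move=> f_inj Gf [_ maxM]; pose g e := (e, f e).
have g_inj : injective g by move=> e e' [].
rewrite -cardsT -(card_imset _ g_inj); apply: maxM; split.
  by move=> e u /imsetP[e' _ [-> ->]].
move=> e u e' u' /imsetP[a _ [-> ->]] /imsetP[b _ [-> ->]].
by case=> [->|/f_inj->].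
Qed.

(** Edges of a matching have distinct equations, so [fst] is injective on [M]; by counting, its
    image is all of [E]. *)
Lemma matching_covers_equations (M : {set E * U}) :
  is_matching G M -> (#|E| <= #|M|)%N -> forall e, ~ unmatched_equation M e.
Proof.
move=> [_ Muniq] leM e unm.
have fst_inj : {in M &, injective fst}.
  by case=> a b [a' b'] Ma Mb /= eqa; apply: Muniq => //; left.
have imT : [set x.1 | x in M] = [set: E].
  by apply/eqP; rewrite eqEcard finset.subsetT cardsT card_in_imset.
have /imsetP[[a b] Mab /= ea] : e \in [set x.1 | x in M] by rewrite imT inE.
by have := unm b; rewrite ea Mab.
Qed.

Lemma matching_covers_unknowns (M : {set E * U}) :
  is_matching G M -> (#|U| <= #|M|)%N -> forall u, ~ unmatched_unknown M u.
Proof.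
move=> [_ Muniq] leM u unm.
have snd_inj : {in M &, injective snd}.
  by case=> a b [a' b'] Ma Mb /= eqb; apply: Muniq => //; right.
have imT : [set x.2 | x in M] = [set: U].
  by apply/eqP; rewrite eqEcard finset.subsetT cardsT card_in_imset.
have /imsetP[[a b] Mab /= ub] : u \in [set x.2 | x in M] by rewrite imT inE.
by have := unm a; rewrite ub Mab.
Qed.

End PerfectMatching.

Theorem proposition2 (R : realType) (d : nat) (K L P : 'M[R]_d)
    (S : 'cV[R]_d -> R) (dt dx : R)
    (hK : skew_symmetric K) (hL : skew_symmetric L)
    (hS : has_linear_gradient S P)
    (hdt : 0 < dt) (hdx : 0 < dx)
    (hinc : structurally_inconsistent K P) :
  coefficient_matrix K P dt \notin unitmx.
Proof.
apply/negP => /unitmx_nonzero_transversal[s As].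
case: hinc => M [Mmax blocks].
(* Equations and unknowns are both indexed by ['I_d], so this one bound serves both sides. *)
have leM : (#|'I_d| <= #|M|)%N.
  apply: (card_maximum_matching_ge _ _ _ s) Mmax; first exact: perm_inj.
  by move=> i; apply/coefficient_matrix_edge/As.
case: Mmax => Mmatch _.
(* A vertex in either block comes with an unmatched vertex from which it is reached. *)
case: blocks => [[_ [e [unm _]]]|[_ [u [unm _]]]].
  exact: (matching_covers_equations _ _ _ _ Mmatch leM e unm).
exact: (matching_covers_unknowns _ _ _ _ Mmatch leM u unm).
Qed.
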